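(* Let $\{A_0=I_{n-1}, A_1, A_2={}^tA_1\}$ be a non-symmetric association scheme of rank $3$ and order $n-1$, put $a=n-1$, and let $\mathcal{D}$ and $\mathcal{Q}$ be the two association schemes of order $4n$ constructed from it in the context. Then, as $\mathbb{Q}$-algebras, we have the following isomorphisms. (1) $\mathbb{Q}\mathcal{D}\cong\mathbb{Q}\oplus\mathbb{Q}\oplus\mathbb{Q}\oplus\mathbb{Q}\oplus \mathrm{M}_2(\mathbb{Q})$. (2) $\mathbb{Q}\mathcal{Q}\cong\mathbb{Q}\oplus\mathbb{Q}\oplus\mathbb{Q}\oplus\mathbb{Q}\oplus\mathbb{Q}(-1,-a)$, where $\mathbb{Q}(-1,-a)$ is a division algebra.
   Context: ${}^tM$ is the transpose of $M$, $I_N$ the $N\times N$ identity matrix, $J_N$ the $N\times N$ all-ones matrix, $\otimes$ the Kronecker product, $\mathrm{M}_2(\mathbb{Q})$ the algebra of $2\times2$ rational matrices. Association scheme: a set $\mathcal{S}=\{S_0,\dots,S_d\}$ of $d+1$ non-zero $N\times N$ matrices with entries in $\{0,1\}$ is an association scheme of order $N$ and rank $d+1$ if (1) $S_0=I_N$; (2) $\sum_{i=0}^d S_i=J_N$; (3) for all $0\le i,j\le d$, ${}^tS_i$ and $S_iS_j$ are linear combinations of $S_0,\dots,S_d$. It is symmetric if ${}^tS_i=S_i$ for all $i$, and non-symmetric otherwise. The rational adjacency algebra is $\mathbb{Q}\mathcal{S}=\bigoplus_{i=0}^d\mathbb{Q}S_i$, a $(d+1)$-dimensional $\mathbb{Q}$-algebra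 under matrix multiplication. Quaternion algebra: for a field $F$ and $r,s\in F\setminus\{0\}$, $F(r,s)$ is the four-dimensional $F$-algebra with basis $1,\boldsymbol{i},\boldsymbol{j},\boldsymbol{k}$ and products determined by $\boldsymbol{i}^2=r$, $\boldsymbol{j}^2=s$, $\boldsymbol{i}\boldsymbol{j}=-\boldsymbol{j}\boldsymbol{i}=\boldsymbol{k}$. Group: let $x,y$ be the permutation matrices $$x=\begin{pmatrix}0&1&0&0\\0&0&1&0\\0&0&0&1\\1&0&0&0\end{pmatrix},\quad y=\begin{pmatrix}0&1&0&0\\1&0&0&0\\0&0&0&1\\0&0&1&0\end{pmatrix}$$ and $G=\langle x,y\rangle\cong D_8$ the group of order $8$ generated by them under matrix multiplication; its identity is $1=I_4$. Let $H=C_G(y)=\{1,x^2,y,x^2y\}$ and $K=C_G(x)=\{1,x,x^2,x^3\}$. Constructions: given the scheme $\{A_0,A_1,A_2\}$ of order $n-1$ (it is known that then $n\equiv 0\pmod 4$), define $n\times n$ block matrices (blocks of sizes $1$ and $n-1$; $\mathbf{1}$ is the all-ones row vector of length $n-1$) $$E=\begin{pmatrix}0&\mathbf{1}\\ {}^t\mathbf{1}&O\end{pmatrix},\quad \tilde{A}_i=\begin{pmatrix}0&0\\0&A_i\end{pmatrix}\ (i=1,2),\quad \hat{A}_1=\begin{pmatrix}0&\mathbf{1}\\ 0&A_1\end{pmatrix},\quad \hat{A}_2=\begin{pmatrix}0&0\\ {}^t\mathbf{1}&A_2\end{pmatrix}.$$ For $g\in H\cup K$ let $\sigma_g=I_n\otimes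 g$. For $g\in G\setminus H$ let $\mu_g=E\otimes g+\tilde{A}_1\otimes gy+\tilde{A}_2\otimes gx^2y$. For $g\in G\setminus K$ let $\tau_g=\hat{A}_1\otimes g+\hat{A}_2\otimes gx^2$. Then $\mathcal{D}=\{\sigma_h\mid h\in H\}\cup\{\mu_g\mid g\in G\setminus H\}$ and $\mathcal{Q}=\{\sigma_k\mid k\in K\}\cup\{\tau_g\mid g\in G\setminus K\}$; both are association schemes of order $4n$ with $8$ elements. *)

(* Defs.v *)
From HB Require Import structures.
From mathcomp Require Import all_boot all_order all_fingroup all_algebra.
From mathcomp Require Import mxtens ring.

Set Implicit Arguments.
Unset Strict Implicit.
Unset Printing Implicit Defensive.
Import GRing.Theory.
Local Open Scope ring_scope.

(* Schemes are duplicate-free sequences of matrices; the rank is [size S]. *)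
Definition assoc_scheme (N : nat) (S : seq 'M[rat]_N) : Prop :=
  [/\ uniq S,
      forall X, X \in S ->
        X != 0 /\ (forall i j, X i j = 0 \/ X i j = 1),
      1%:M \in S,
      \sum_(X <- S) X = const_mx 1
    & forall X Y, X \in S -> Y \in S ->
        X^T \in <<S>>%VS /\ X *m Y \in <<S>>%VS].

Definition symmetric_scheme (N : nat) (S : seq 'M[rat]_N) : Prop :=
  forall X, X \in S -> X^T = X.

Definition adjacency_algebra (N : nat) (S : seq 'M[rat]_N) :
  {vspace 'M[rat]_N} := <<S>>%VS.

(* [U] is a unital subalgebra of the matrix algebra, and the corestriction of
   [f] to [U] is an isomorphism of algebras from [B] onto [U]. *)
Definition matalg_isog (N : nat) (U : {vspace 'M[rat]_N}) (B : algType rat) :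
    Prop :=
  exists f : {linear B -> 'M[rat]_N},
    [/\ f 1 = 1%:M,
        {morph f : b c / b * c >-> b *m c},
        injective f
      & forall X : 'M[rat]_N, X \in U <-> exists b : B, X = f b].

Definition division_algebra (F : fieldType) (B : algType F) : Prop :=
  forall u : B, u != 0 -> exists v : B, u * v = 1 /\ v * u = 1.

(* F(r,s), coordinates being taken in the basis 1, i, j, k. The product, which
   depends on r and s, is [quat_mul] below; r and s need not be nonzero for it
   to define an algebra. *)
Definition quaternion (F : fieldType) (r s : F) : Type := 'rV[F]_4.

Section Quaternion.
Variables (F : fieldType) (r s : F).
Local Notation quaternion := (quaternion r s).

HB.instance Definition _ := Vector.copy quaternion 'rV[F]_4.

Definition Quat (a b c d : F) : quaternion :=
  \row_(l < 4) [:: a; b; c; d]`_l.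

Implicit Types u v w : quaternion.

(* From i^2 = r, j^2 = s and k = ij = -ji one gets k^2 = -rs, ik = rj = -ki
   and kj = si = -jk. *)
Definition quat_mul u v : quaternion :=
  let: (a, b, c, d) := (u 0 0, u 0 1, u 0 2, u 0 3) in
  let: (a', b', c', d') := (v 0 0, v 0 1, v 0 2, v 0 3) in
  Quat (a * a' + r * (b * b') + s * (c * c') - r * s * (d * d'))
       (a * b' + b * a' - s * (c * d') + s * (d * c'))
       (a * c' + c * a' + r * (b * d') - r * (d * b'))
       (a * d' + d * a' + b * c' - c * b').

Definition quat_one : quaternion := Quat 1 0 0 0.

Let quatP u v :
  [/\ u 0 0 = v 0 0, u 0 1 = v 0 1, u 0 2 = v 0 2 & u 0 3 = v 0 3] -> u = v.
Proof.
case=> e0 e1 e2 e3; apply/rowP => -[[|[|[|[|//]]]] lt_l4].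
- by move: e0; congr (u 0 _ = v 0 _); apply/val_inj.
- by move: e1; congr (u 0 _ = v 0 _); apply/val_inj.
- by move: e2; congr (u 0 _ = v 0 _); apply/val_inj.
- by move: e3; congr (u 0 _ = v 0 _); apply/val_inj.
Qed.

Fact quat_mulA : associative quat_mul.
Proof. by move=> u v w; apply: quatP; rewrite !mxE /=; split; ring. Qed.

Fact quat_mul1q : left_id quat_one quat_mul.
Proof. by move=> u; apply: quatP; rewrite !mxE /=; split; ring. Qed.

Fact quat_mulq1 : right_id quat_one quat_mul.
Proof. by move=> u; apply: quatP; rewrite !mxE /=; split; ring. Qed.

Fact quat_mulDl : left_distributive quat_mul +%R.
Proof. by move=> u v w; apply: quatP; rewrite !mxE /=; split; ring. Qed.

Fact quat_mulDr : right_distributive quat_mul +%R.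
Proof. by move=> u v w; apply: quatP; rewrite !mxE /=; split; ring. Qed.

Fact quat_one_neq0 : quat_one != 0.
Proof. by apply/eqP => /rowP/(_ 0)/eqP; rewrite !mxE /= oner_eq0. Qed.

HB.instance Definition _ := GRing.Zmodule_isNzRing.Build quaternion
  quat_mulA quat_mul1q quat_mulq1 quat_mulDl quat_mulDr quat_one_neq0.

Fact quat_scaleAl (a : F) u v : a *: (u * v) = (a *: u) * v.
Proof. by apply: quatP; rewrite !mxE /=; split; ring. Qed.

HB.instance Definition _ :=
  GRing.Lmodule_isLalgebra.Build F quaternion quat_scaleAl.

Fact quat_scaleAr (a : F) u v : a *: (u * v) = u * (a *: v).
Proof. by apply: quatP; rewrite !mxE /=; split; ring. Qed.

HB.instance Definition _ :=
  GRing.Lalgebra_isAlgebra.Build F quaternion quat_scaleAr.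

Let qi := Quat 0 1 0 0.
Let qj := Quat 0 0 1 0.
Let qk := Quat 0 0 0 1.

Lemma quat_relations :
  [/\ qi * qi = r%:A, qj * qj = s%:A, qi * qj = qk & qj * qi = - qk].
Proof. by split; apply: quatP; rewrite !mxE /=; split; ring. Qed.

End Quaternion.

(* The group generated by x and y is realised by permutations of {0, 1, 2, 3};
   [perm_mx] is an injective morphism sending [x] and [y] to the generating
   matrices. *)
Definition x : 'S_4 := perm (@addIr _ (1 : 'I_4)).
Definition y : 'S_4 := (tperm 0%R 1%R * tperm 2%R 3%R)%g.

Lemma perm_mx_x : perm_mx x = \matrix_(i < 4, j < 4)
  (nth [::] [:: [:: 0; 1; 0; 0];
                [:: 0; 0; 1; 0];
                [:: 0; 0; 0; 1];
                [:: 1; 0; 0; 0]] i)`_j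
  :> 'M[rat]_4.
Proof.
apply/matrixP => i j; rewrite !mxE permE.
by case: i => -[|[|[|[|//]]]] ?; case: j => -[|[|[|[|//]]]] ?.
Qed.

Lemma perm_mx_y : perm_mx y = \matrix_(i < 4, j < 4)
  (nth [::] [:: [:: 0; 1; 0; 0];
                [:: 1; 0; 0; 0];
                [:: 0; 0; 0; 1];
                [:: 0; 0; 1; 0]] i)`_j
  :> 'M[rat]_4.
Proof.
apply/matrixP => i j; rewrite !mxE !permE /=.
by case: i => -[|[|[|[|//]]]] ?; case: j => -[|[|[|[|//]]]] ?; rewrite !permE.
Qed.

Definition G : {group 'S_4} := <<[set x; y]>>%G.
Definition H : {group 'S_4} := 'C_G[y]%G.
Definition K : {group 'S_4} := 'C_G[x]%G.

Section Constructions.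
(* [a] is n - 1. *)
Variables (a : nat) (A1 A2 : 'M[rat]_a).

Definition Emx : 'M[rat]_(1 + a) :=
  block_mx 0 (const_mx 1) (const_mx 1) 0.
Definition Atilde (A : 'M[rat]_a) : 'M[rat]_(1 + a) :=
  block_mx 0 0 0 A.
Definition Ahat1 : 'M[rat]_(1 + a) := block_mx 0 (const_mx 1) 0 A1.
Definition Ahat2 : 'M[rat]_(1 + a) := block_mx 0 0 (const_mx 1) A2.

Definition sigma (g : 'S_4) : 'M[rat]_((1 + a) * 4) := 1%:M *t perm_mx g.

Definition mu (g : 'S_4) : 'M[rat]_((1 + a) * 4) :=
  Emx *t perm_mx g + Atilde A1 *t perm_mx (g * y)%g
  + Atilde A2 *t perm_mx (g * x ^+ 2 * y)%g.

Definition tau (g : 'S_4) : 'M[rat]_((1 + a) * 4) :=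
  Ahat1 *t perm_mx g + Ahat2 *t perm_mx (g * x ^+ 2)%g.

Definition scheme_D : seq 'M[rat]_((1 + a) * 4) :=
  [seq sigma h | h in H] ++ [seq mu g | g in G :\: H].

Definition scheme_Q : seq 'M[rat]_((1 + a) * 4) :=
  [seq sigma k | k in K] ++ [seq tau g | g in G :\: K].

End Constructions.

(* Main.v *)
Require Import Defs.
From HB Require Import structures.
From mathcomp Require Import all_boot all_order all_fingroup all_algebra.
From mathcomp Require Import mxtens ring lra.

(* Put [z = sigma x^2]. For the first scheme let [t = sigma y], [w = mu x] and
   [r = 1]; for the second let [t = sigma x], [w = tau (x y)] and [r = -1]. In
   both cases the scheme consists of 1, t, z, zt, w, tw, zw, ztw, and
     z is central,  z^2 = 1,  w t = z t w,  w^2 = a z + (a - 1)/2 (1 + z) w,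
   while t^2 is 1 on the summand [z = 1] and [r] on the summand [z = -1]. The
   summand [z = 1] is commutative with [t^2 = 1] and [(w - a)(w + 1) = 0], which
   gives four copies of the rationals; on the summand [z = -1] one has
   [t^2 = r], [w^2 = -a] and [w t = - t w], which is the quaternion algebra
   Q(r, -a). It splits for [r = 1] and its norm form is definite for [r = -1]. *)

Set Implicit Arguments.
Unset Strict Implicit.
Unset Printing Implicit Defensive.

Import Order.TTheory GRing.Theory Num.Theory.
Local Open Scope ring_scope.

(** * Products in an algebra spanned by [e], [t], [w] and [t w] *)

Definition comb4 (R : pzRingType) (V : lmodType R) (e0 e1 e2 e3 : V)
    (c0 c1 c2 c3 : R) : V :=
  c0 *: e0 + c1 *: e1 + c2 *: e2 + c3 *: e3.

(** One multiplication table serves both summands: the commutative one with [q = 1], [s = a],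
    [k = a - 1], and the quaternion one with [q = -1], [s = -a], [k = 0]. *)
Lemma comb4_mul N (e t w : 'M[rat]_N) (r s k q c0 c1 c2 c3 d0 d1 d2 d3 : rat) :
  e *m e = e -> e *m t = t -> t *m e = t -> e *m w = w -> w *m e = w ->
  t *m t = r *: e -> w *m w = s *: e + k *: w -> w *m t = q *: (t *m w) ->
  comb4 e t w (t *m w) c0 c1 c2 c3 *m comb4 e t w (t *m w) d0 d1 d2 d3 =
  comb4 e t w (t *m w)
    (c0 * d0 + r * (c1 * d1) + s * (c2 * d2) + q * r * s * (c3 * d3))
    (c0 * d1 + c1 * d0 + q * s * (c2 * d3) + s * (c3 * d2))
    (c0 * d2 + c2 * d0 + r * (c1 * d3) + k * (c2 * d2) + q * r * (c3 * d1)
       + q * r * k * (c3 * d3))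
    (c0 * d3 + c3 * d0 + c1 * d2 + q * (c2 * d1) + q * k * (c2 * d3)
       + k * (c3 * d2)).
Proof.
move=> ee et te ew we tt ww wt.
have etw : e *m (t *m w) = t *m w by rewrite mulmxA et.
have twe : t *m w *m e = t *m w by rewrite -mulmxA we.
have ttw : t *m (t *m w) = r *: w by rewrite mulmxA tt -scalemxAl ew.
have tww : t *m w *m w = s *: t + k *: (t *m w).
  by rewrite -mulmxA ww mulmxDr -!scalemxAr te.
have wtw : w *m (t *m w) = (q * s) *: t + (q * k) *: (t *m w).
  by rewrite mulmxA wt -scalemxAl tww scalerDr !scalerA.
have twt : t *m w *m t = (q * r) *: w.
  by rewrite -mulmxA wt -scalemxAr ttw scalerA.
have twtw : t *m w *m (t *m w) = (q * r * s) *: e + (q * r * k) *: w.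
  by rewrite mulmxA twt -scalemxAl ww scalerDr !scalerA.
rewrite /comb4 !mulmxDl !mulmxDr -!scalemxAl -!scalemxAr.
rewrite ee et te ew we tt ww wt etw twe ttw tww wtw twt twtw.
by apply/matrixP => i j; rewrite !mxE; ring.
Qed.

Lemma comb4_idl N (e t w : 'M[rat]_N) c0 c1 c2 c3 :
  e *m e = e -> e *m t = t -> e *m w = w ->
  e *m comb4 e t w (t *m w) c0 c1 c2 c3 = comb4 e t w (t *m w) c0 c1 c2 c3.
Proof.
by move=> ee et ew; rewrite /comb4 !mulmxDr -!scalemxAr mulmxA ee et ew.
Qed.

Lemma comb4_idr N (e t w : 'M[rat]_N) c0 c1 c2 c3 :
  e *m e = e -> t *m e = t -> w *m e = w ->
  comb4 e t w (t *m w) c0 c1 c2 c3 *m e = comb4 e t w (t *m w) c0 c1 c2 c3.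
Proof.
by move=> ee te we; rewrite /comb4 !mulmxDl -!scalemxAl -mulmxA ee te we.
Qed.

Lemma comb4_linear (R : comPzRingType) (V : lmodType R) (e0 e1 e2 e3 : V)
    (l c0 c1 c2 c3 d0 d1 d2 d3 : R) :
  comb4 e0 e1 e2 e3 (l * c0 + d0) (l * c1 + d1) (l * c2 + d2) (l * c3 + d3) =
  l *: comb4 e0 e1 e2 e3 c0 c1 c2 c3 + comb4 e0 e1 e2 e3 d0 d1 d2 d3.
Proof.
rewrite /comb4 !scalerDl !scalerDr !scalerA.
by rewrite [RHS]addrACA; congr (_ + _); rewrite [RHS]addrACA; congr (_ + _);
   rewrite [RHS]addrACA.
Qed.

(** * Splitting by the central involution [z] *)

Section Decomposition.
Variables (N : nat) (t w z : 'M[rat]_N) (r a : rat).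
Hypotheses (zz : z *m z = 1%:M) (zt : z *m t = t *m z) (zw : z *m w = w *m z).
(* [t^2] is 1 where [z = 1] and [r] where [z = -1]. *)
Hypothesis tt : t *m t = ((1 + r) / 2) *: 1%:M + ((1 - r) / 2) *: z.
Hypothesis wt : w *m t = z *m t *m w.
Hypothesis ww : w *m w = a *: z + ((a - 1) / 2) *: (w + z *m w).
Hypothesis a_neqN1 : a + 1 != 0.

(** [p] and [e] are the complementary idempotents that cut out the summands [z = 1] and [z = -1]. *)
Let p := 2^-1 *: (1%:M + z).
Let e := 2^-1 *: (1%:M - z).

Let pp : p *m p = p.
Proof.
rewrite /p -!scalemxAl -!scalemxAr !mulmxDl !mulmxDr !mul1mx !mulmx1 zz.
by apply/matrixP => i j; rewrite !mxE; field.
Qed.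

Let ee : e *m e = e.
Proof.
rewrite /e -!scalemxAl -!scalemxAr !mulmxBl !mulmxBr !mul1mx !mulmx1 zz.
by apply/matrixP => i j; rewrite !mxE; field.
Qed.

Let pe : p *m e = 0.
Proof.
rewrite /e /p -!scalemxAl -!scalemxAr !mulmxDl !mulmxBr !mul1mx !mulmx1 zz.
by apply/matrixP => i j; rewrite !mxE; field.
Qed.

Let pe1 : p + e = 1%:M.
Proof. by apply/matrixP => i j; rewrite !mxE; field. Qed.

Let ep : e *m p = 0.
Proof.
rewrite /e /p -!scalemxAl -!scalemxAr !mulmxBl !mulmxDr !mul1mx !mulmx1 zz.
by apply/matrixP => i j; rewrite !mxE; field.
Qed.

Let ez : e *m z = - e.
Proof.
rewrite /e -!scalemxAl !mulmxBl !mul1mx zz.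
by apply/matrixP => i j; rewrite !mxE; field.
Qed.

Let pz : p *m z = p.
Proof.
rewrite /p -!scalemxAl !mulmxDl !mul1mx zz.
by apply/matrixP => i j; rewrite !mxE; field.
Qed.

Let comm_p u : z *m u = u *m z -> p *m u = u *m p.
Proof.
by move=> zu; rewrite -scalemxAl -scalemxAr mulmxDl mulmxDr zu mulmx1 mul1mx.
Qed.

Let comm_e u : z *m u = u *m z -> e *m u = u *m e.
Proof.
by move=> zu; rewrite -scalemxAl -scalemxAr mulmxBl mulmxBr zu mulmx1 mul1mx.
Qed.

Let mulip (i u v : 'M[rat]_N) : i *m i = i -> i *m u = u *m i ->
  (i *m u) *m (i *m v) = i *m (u *m v).
Proof. by move=> ii iu; rewrite {1}iu -!mulmxA (mulmxA i i) ii !mulmxA iu. Qed.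

(* The four factors [rat] are the points [(t, w) = (1, a), (1, -1), (-1, a)]
   and [(-1, -1)]; the coefficients interpolate the values taken there. *)
Definition interp (c : rat * rat * rat * rat) : 'M[rat]_N :=
  let: (c0, c1, c2, c3) := c in
  comb4 p (p *m t) (p *m w) (p *m t *m (p *m w))
    ((c0 + c2 + a * (c1 + c3)) / (2 * (a + 1)))
    ((c0 - c2 + a * (c1 - c3)) / (2 * (a + 1)))
    ((c0 + c2 - c1 - c3) / (2 * (a + 1)))
    ((c0 - c2 - c1 + c3) / (2 * (a + 1))).

Definition quat_emb (c : quaternion r (- a)) : 'M[rat]_N :=
  comb4 e (e *m t) (e *m w) (e *m t *m (e *m w)) (c 0 0) (c 0 1) (c 0 2) (c 0 3).

Definition decomp
    (c : rat^o * rat^o * rat^o * rat^o * quaternion r (- a)) : 'M[rat]_N :=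
  interp c.1 + quat_emb c.2.

Lemma interp_mul b c : interp (b * c) = interp b *m interp c.
Proof.
case: b c => -[[b0 b1] b2] b3 [[[c0 c1] c2] c3].
rewrite [RHS](comb4_mul (r := 1) (s := a) (k := a - 1) (q := 1)).
- by congr comb4; rewrite /=; field; rewrite a_neqN1.
- exact: pp.
- by rewrite mulmxA pp.
- by rewrite -mulmxA -comm_p // mulmxA pp.
- by rewrite mulmxA pp.
- by rewrite -mulmxA -comm_p // mulmxA pp.
(* Since [p z = p], the two coefficients of [t^2] add up to 1; against [e], where [e z = -e], their
   difference is [r]. *)
- rewrite (mulip _ pp (comm_p zt)) tt mulmxDr -!scalemxAr mulmx1 pz -scalerDl.
  by congr (_ *: _); field.
- rewrite (mulip _ pp (comm_p zw)) ww mulmxDr -!scalemxAr mulmxDr mulmxA pz.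
  by rewrite -mulr2n -scaler_nat scalerA; congr (_ + _ *: _); field.
- by rewrite scale1r (mulip _ pp (comm_p zw)) (mulip _ pp (comm_p zt)) wt !mulmxA pz.
Qed.

Lemma quat_emb_mul b c : quat_emb (b * c) = quat_emb b *m quat_emb c.
Proof.
rewrite [RHS](comb4_mul (r := r) (s := - a) (k := 0) (q := - 1)).
- by rewrite /quat_emb !mxE /=; congr comb4; ring.
- exact: ee.
- by rewrite mulmxA ee.
- by rewrite -mulmxA -comm_e // mulmxA ee.
- by rewrite mulmxA ee.
- by rewrite -mulmxA -comm_e // mulmxA ee.
- rewrite (mulip _ ee (comm_e zt)) tt mulmxDr -!scalemxAr mulmx1 ez scalerN -scalerBl.
  by congr (_ *: _); field.
(* Here [e (w + z w) = 0], so the linear part of [w^2] disappears. *)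
- rewrite (mulip _ ee (comm_e zw)) ww mulmxDr -!scalemxAr mulmxDr mulmxA ez mulNmx.
  by rewrite subrr scaler0 scale0r scalerN scaleNr.
- rewrite (mulip _ ee (comm_e zw)) (mulip _ ee (comm_e zt)) wt.
  by rewrite !mulmxA ez scaleN1r !mulNmx.
Qed.

Lemma decomp_is_linear : linear decomp.
Proof.
have scaleE (u : rat) (v : rat^o) : u *: v = u * v by [].
move=> l [[[[b0 b1] b2] b3] b] [[[[c0 c1] c2] c3] c].
rewrite /decomp /interp /quat_emb /= scalerDr [RHS]addrACA.
rewrite -!comb4_linear; congr (_ + _); congr comb4; rewrite ?mxE ?scaleE //;
  by field.
Qed.


Lemma interp_idl c : p *m interp c = interp c.
Proof.
by case: c => -[[c0 c1] c2] c3; apply: comb4_idl; rewrite ?mulmxA pp.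
Qed.

Lemma interp_idr c : interp c *m p = interp c.
Proof.
by case: c => -[[c0 c1] c2] c3; apply: comb4_idr;
   rewrite // -mulmxA -comm_p // mulmxA pp.
Qed.

Lemma quat_emb_idl c : e *m quat_emb c = quat_emb c.
Proof. by apply: comb4_idl; rewrite ?mulmxA ee. Qed.

Lemma quat_emb_idr c : quat_emb c *m e = quat_emb c.
Proof. by apply: comb4_idr; rewrite // -mulmxA -comm_e // mulmxA ee. Qed.

Lemma interp_quat_emb b c : interp b *m quat_emb c = 0.
Proof.
by rewrite -interp_idr -quat_emb_idl mulmxA -(mulmxA _ p) pe mulmx0 mul0mx.
Qed.

Lemma quat_emb_interp b c : quat_emb b *m interp c = 0.
Proof.
by rewrite -interp_idl -quat_emb_idr mulmxA -(mulmxA _ e) ep mulmx0 mul0mx.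
Qed.

Lemma decomp_mul : {morph decomp : b c / b * c >-> b *m c}.
Proof.
move=> b c; rewrite /decomp mulmxDl (mulmxDr (interp b.1)) (mulmxDr (quat_emb b.2))
  interp_quat_emb quat_emb_interp.
by rewrite add0r addr0 -interp_mul -quat_emb_mul.
Qed.

Lemma decomp1 : decomp 1 = 1%:M.
Proof.
rewrite -pe1 /decomp; congr (_ + _); rewrite /interp /quat_emb /comb4 /= ?mxE /=.
  by apply/matrixP => i j; rewrite !(mulmxA, mxE); field.
by rewrite scale1r !scale0r !addr0.
Qed.

(** The preimages of [z], [t] and [w] list their values at the four points [(t, w)], followed by
    [-1], [i] and [j] respectively in the quaternion factor. They serve to prove surjectivity. *)
Lemma decomp_z : decomp (1, 1, 1, 1, -1) = z.
Proof.
have -> : z = p - e by apply/matrixP => i j; rewrite !mxE; field.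
rewrite /decomp; congr (_ + _); rewrite /interp /quat_emb /comb4 /= ?mxE /=.
  by apply/matrixP => i j; rewrite !(mulmxA, mxE); field.
by rewrite oppr0 scaleN1r !scale0r !addr0.
Qed.

Lemma decomp_t : decomp (1, 1, -1, -1, Quat r (- a) 0 1 0 0) = t.
Proof.
rewrite -[RHS]mul1mx -pe1 mulmxDl.
rewrite /decomp; congr (_ + _); rewrite /interp /quat_emb /comb4 /= ?mxE /=.
  by apply/matrixP => i j; rewrite !(mulmxA, mxE); field.
by rewrite scale1r !scale0r !addr0 add0r.
Qed.

Lemma decomp_w : decomp (a, -1, a, -1, Quat r (- a) 0 0 1 0) = w.
Proof.
rewrite -[RHS]mul1mx -pe1 mulmxDl.
rewrite /decomp; congr (_ + _); rewrite /interp /quat_emb /comb4 /= ?mxE /=.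
  by apply/matrixP => i j; rewrite !(mulmxA, mxE); field.
by rewrite scale1r !scale0r !addr0 add0r.
Qed.

End Decomposition.

(** * From generators and a dimension count to the isomorphism *)

Lemma matalg_isog_dim N (U : {vspace 'M[rat]_N}) r s
    (f : rat^o * rat^o * rat^o * rat^o * quaternion r s -> 'M[rat]_N) :
  linear f -> f 1 = 1%:M -> {morph f : b c / b * c >-> b *m c} ->
  (forall X, X \in U -> exists b, X = f b) -> (8 <= \dim U)%N ->
  matalg_isog U (rat^o * rat^o * rat^o * rat^o * quaternion r s)%type.
Proof.
move=> f_lin f1 fM f_surj dimU.
pose fL := GRing.isLinear.Build _ _ _ _ f f_lin.
pose F : {linear _ -> _} := HB.pack f fL.
pose h := linfun F.
have hE b : h b = F b by rewrite lfunE.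
have sUh : (U <= limg h)%VS.
  by apply/subvP => X /f_surj[b ->]; rewrite -[f b](hE b) memv_img ?memvf.
(* Rank-nullity: the source has dimension 8 and the image contains [U], of dimension at least 8, so
   the image is [U] and the kernel is zero. *)
have := limg_ker_dim h fullv; rewrite capfv dimvf.
have -> : dim (rat^o * rat^o * rat^o * rat^o * quaternion r s)%type = 8%N by [].
move=> dim8.
have dimh : (\dim (limg h) <= \dim U)%N.
  by apply: leq_trans dimU; rewrite -dim8 leq_addl.
have Uh : U = limg h by apply/eqP; rewrite eqEdim sUh.
exists F; split => //.
- suff /lker0P h_inj : lker h == 0%VS by move=> b c Fbc; apply: h_inj; rewrite !hE.
  rewrite -dimv_eq0 -leqn0 -(leq_add2r (\dim (limg h))) dim8 add0n.
  exact: leq_trans (dimvS sUh).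
- move=> X; split=> [|[b ->]]; first exact: f_surj.
  by rewrite Uh -[F b](hE b) memv_img ?memvf.
Qed.

(** [decomp] covers the span because its image contains [1], [t], [w], [z] and is closed under
    products; freeness supplies the dimension 8. *)
Lemma twisted_isog N (t w z : 'M[rat]_N) (r a : rat) :
  z *m z = 1%:M -> z *m t = t *m z -> z *m w = w *m z ->
  t *m t = ((1 + r) / 2) *: 1%:M + ((1 - r) / 2) *: z ->
  w *m t = z *m t *m w ->
  w *m w = a *: z + ((a - 1) / 2) *: (w + z *m w) ->
  a + 1 != 0 ->
  let S := [:: 1%:M; t; z; z *m t; w; t *m w; z *m w; z *m t *m w] in
  free S ->
  matalg_isog <<S>>%VS
    (rat^o * rat^o * rat^o * rat^o * quaternion r (- a))%type.
Proof.
move=> zz zt zw tt wt ww a1 S freeS.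
have fL := @decomp_is_linear _ t w z r a a1.
pose f := @decomp N t w z r a; rewrite -/f in fL.
have f0 : f 0 = 0 by rewrite -[0 in LHS](addNr 0) -scaleN1r fL scaleN1r addNr.
have f1 : f 1 = 1%:M := decomp1 t w z r a1.
have fM : {morph f : b c / b * c >-> b *m c} by exact: decomp_mul.
have ft := decomp_t t w z r a1; have fw := decomp_w t w z r a1.
have fz := decomp_z t w z r a1.
apply: (matalg_isog_dim fL) => //; last by rewrite (eqnP freeS).
have imM X Y : (exists b, X = f b) -> (exists b, Y = f b) ->
    exists b, X *m Y = f b.
  by move=> [b ->] [c ->]; exists (b * c); rewrite fM.
have imt : exists b, t = f b by eexists; rewrite -[LHS]ft.
have imw : exists b, w = f b by eexists; rewrite -[LHS]fw.
have imz : exists b, z = f b by eexists; rewrite -[LHS]fz.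
have imzt := imM _ _ imz imt.
have imS X : X \in S -> exists b, X = f b.
  rewrite !inE; do ?case/orP; move/eqP => -> //; try exact: imM.
  by exists 1.
move=> X; rewrite -[S]/(tval (in_tuple S)) => /coord_span ->.
apply: (big_ind (fun Y => exists b, Y = f b)).
- by exists 0.
(* Linearity of [f] has the shape [l *: b + c], so sums take [l = 1] and multiples take [c = 0]. *)
- by move=> _ _ [b ->] [c ->]; exists (1 *: b + c); rewrite fL scale1r.
- move=> i _; have /imS[b ->] : (in_tuple S)`_i \in S by apply: mem_nth.
  exists (coord (in_tuple S) i X *: b + 0); by rewrite fL f0 addr0.
Qed.

(** * Split and definite quaternion algebras *)

Definition quat_of_mx s (m : 'M[rat]_2) : quaternion 1 s :=
  Quat 1 s ((m 0 0 + m 1 1) / 2) ((m 0 0 - m 1 1) / 2)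
    ((m 0 1 + m 1 0 / s) / 2) ((m 0 1 - m 1 0 / s) / 2).

(** The splitting of Q(1, s) that sends [i] to diag(1, -1) and [j] to the matrix with rows (0, 1)
    and (s, 0). *)
Definition mx_of_quat s (u : quaternion 1 s) : 'M[rat]_2 :=
  \matrix_(i, j) if i == 0
    then (if j == 0 then u 0 0 + u 0 1 else u 0 2 + u 0 3)
    else (if j == 0 then s * (u 0 2 - u 0 3) else u 0 0 - u 0 1).

Lemma row4P (R : Type) (u v : 'rV[R]_4) :
  [/\ u 0 0 = v 0 0, u 0 1 = v 0 1, u 0 2 = v 0 2 & u 0 3 = v 0 3] -> u = v.
Proof.
case=> e0 e1 e2 e3; apply/rowP => -[[|[|[|[|//]]]] i].
- by move: e0; congr (u 0 _ = v 0 _); apply/val_inj.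
- by move: e1; congr (u 0 _ = v 0 _); apply/val_inj.
- by move: e2; congr (u 0 _ = v 0 _); apply/val_inj.
- by move: e3; congr (u 0 _ = v 0 _); apply/val_inj.
Qed.

Lemma quat_of_mxK s : s != 0 -> cancel (@quat_of_mx s) (@mx_of_quat s).
Proof.
move=> s0 m; apply/matrixP => i j.
have ord2 (k : 'I_2) : k = 0 \/ k = 1.
  by case: k => -[|[|//]] k; [left | right]; apply/val_inj.
by case: (ord2 i) => ->; case: (ord2 j) => ->; rewrite !mxE /=; field;
   rewrite ?s0.
Qed.

Lemma mx_of_quatK s : s != 0 -> cancel (@mx_of_quat s) (@quat_of_mx s).
Proof.
by move=> s0 u; apply: row4P; rewrite !mxE /=; split; field; rewrite ?s0.
Qed.

Lemma quat_of_mxM s : s != 0 -> {morph @quat_of_mx s : m n / m * n}.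
Proof.
have ord1E : lift ord0 ord0 = 1 :> 'I_2 by apply/val_inj.
move=> s0 m n; apply: row4P; rewrite !mxE !big_ord_recl !big_ord0 /= !ord1E.
by split; field; rewrite ?s0.
Qed.

Lemma matalg_isog_mx2 N (U : {vspace 'M[rat]_N}) s : s != 0 ->
  matalg_isog U (rat^o * rat^o * rat^o * rat^o * quaternion (1 : rat) s)%type ->
  matalg_isog U (rat^o * rat^o * rat^o * rat^o * 'M[rat]_2)%type.
Proof.
move=> s0 [f [f1 fM f_inj fU]].
pose q (b : rat^o * rat^o * rat^o * rat^o * 'M[rat]_2) := (b.1, quat_of_mx s b.2).
have q_lin : linear (f \o q).
  move=> l b c; rewrite /= -linearP; congr (f (_, _)).
  by apply/rowP => -[[|[|[|[|//]]]] i]; rewrite !mxE /=; field; rewrite ?s0.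
pose F : {linear _ -> _} := HB.pack (f \o q) (GRing.isLinear.Build _ _ _ _ _ q_lin).
exists F; split.
- rewrite -f1; congr (f (_, _)).
  by apply/rowP => -[[|[|[|[|//]]]] i]; rewrite !mxE /=; field; rewrite ?s0.
- move=> b c; rewrite -fM; congr (f (_, _)).
  exact: quat_of_mxM.
- by move=> [b1 b2] [c1 c2] /f_inj[-> /(can_inj (quat_of_mxK s0))->].
- move=> X; rewrite fU; split=> [[[b1 b2] ->]|[b ->]]; last by exists (q b).
  by exists (b1, mx_of_quat b2); rewrite /= /q /= mx_of_quatK.
Qed.

(** The norm [n] is a sum of squares with positive weights, hence vanishes only at 0; the inverse is
    the conjugate divided by the norm. *)
Lemma quaternion_division (a : rat) : 0 < a ->
  division_algebra (quaternion (-1 : rat) (- a)).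
Proof.
move=> a0 u u0.
pose n := u 0 0 ^+ 2 + u 0 1 ^+ 2 + a * (u 0 2 ^+ 2 + u 0 3 ^+ 2).
have n0 : n != 0.
  apply: contraNneq u0 => /eqP.
  have sq k : 0 <= u 0 k ^+ 2 by apply: sqr_ge0.
  rewrite /n paddr_eq0 ?(addr_ge0 (sq _)) ?(mulr_ge0 (ltW a0)) ?addr_ge0 //.
  rewrite (mulf_eq0 a) (gt_eqF a0) /= !paddr_eq0 // !sqrf_eq0.
  case/andP => /andP[/eqP u0' /eqP u1] /andP[/eqP u2 /eqP u3].
  by apply/eqP/row4P; rewrite !mxE.
exists
  (n^-1 *: (Quat (-1) (- a) (u 0 0) (- u 0 1) (- u 0 2) (- u 0 3) : quaternion _ _)).
by split; apply: row4P; rewrite !mxE /= /n; split; field; apply: n0.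
Qed.

(** * The dihedral group and the centralizers of its generators *)

Lemma ord4P (k : 'I_4) : [\/ k = 0, k = 1, k = 2 | k = 3].
Proof.
by case: k => -[|[|[|[|//]]]] k;
   [constructor 1 | constructor 2 | constructor 3 | constructor 4]; apply/val_inj.
Qed.

Lemma xE : (x 0 = 1) * (x 1 = 2) * (x 2 = 3) * (x 3 = 0).
Proof. by do !split; rewrite permE; apply/val_inj. Qed.

Lemma yE : (y 0 = 1) * (y 1 = 0) * (y 2 = 3) * (y 3 = 2).
Proof. by do !split; rewrite !permE /= !permE. Qed.

Lemma perm4P (g h : 'S_4) :
  [/\ g 0 = h 0, g 1 = h 1, g 2 = h 2 & g 3 = h 3] -> g = h.
Proof. by case=> *; apply/permP => k; case: (ord4P k) => ->. Qed.

(* [x] and [y] are generalised so that [permM] does not unfold them. *)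
Ltac perm_eval :=
  let hx := fresh in let hy := fresh in
  move: x y xE yE; intros ? ? hx hy;
  rewrite /= !(expgS, expg0, permM, perm1, hx, hy).

Ltac perm4 := by apply: perm4P; perm_eval.

Local Notation z := (x ^+ 2)%g.

(** Conjugation by [y] inverts [x], so the group is the product of [<[x]>] and [<[y]>], and
    exponents can be reduced modulo 4 and 2. *)
Lemma G_enum : G :=: [set 1; x; z; z * x; y; y * x; z * y; z * y * x]%g.
Proof.
have x4 : (x ^+ 4 = 1)%g by perm4.
have y2 : (y ^+ 2 = 1)%g by perm4.
apply/eqP; rewrite eqEsubset; apply/andP; split; last first.
  have [Gx Gy] : x \in G /\ y \in G.
    by split; apply: mem_gen; rewrite !inE eqxx ?orbT.
  by do !(rewrite subUset; apply/andP; split); rewrite sub1set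
    ?(Gx, Gy, groupX, groupM, group1).
(* These rules bring [x^i y^j] to the listed form, with powers of [z], [y], [x] in this order. *)
have x3 : (x ^+ 3 = z * x)%g by perm4.
have xy : (x * y = z * y * x)%g by perm4.
have zxy : (z * x * y = y * x)%g by perm4.
have xyN : (<[y]> \subset 'N(<[x]>))%g.
  rewrite cycle_subG; apply/normP; rewrite -cycleJ (_ : x ^ y = x^-1)%g ?cycleV //.
  apply: (mulgI x); rewrite mulgV; apply: (mulgI y); rewrite conjgE.
  have yK : (y^-1 = y)%g by apply/(mulgI y); rewrite mulgV -[LHS]y2.
  by rewrite yK; perm4.
rewrite /G /= -[<<_>>%g]/([set x] <*> [set y])%g -joing_idl -joing_idr
  norm_joinEr //.
apply/subsetP => _ /mulsgP[_ _ /cycleP[i ->] /cycleP[j ->] ->].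
rewrite -(expg_mod i x4) -(expg_mod j y2).
have := ltn_pmod i (isT : 0 < 4)%N; have := ltn_pmod j (isT : 0 < 2)%N.
case: (j %% 2)%N => [|[|//]] _; case: (i %% 4)%N => [|[|[|[|//]]]] _.
all: rewrite !inE ?expg0 ?expg1 ?mulg1 ?mul1g ?x3 ?xy ?zxy ?eqxx ?orbT //.
Qed.

(** One point suffices to refute commutation; below it is always the point 0. *)
Lemma perm_notin_cent1 (T : finType) (g h : {perm T}) a :
  (h * g)%g a != (g * h)%g a -> (g \in 'C[h])%g = false.
Proof. by move=> ne; apply: contraNF ne => /cent1P ->. Qed.

(** Here and in the next three lemmas the elements are listed in the order [1, t, z, z t] or
    [w, t w, z w, z t w] of [twisted_isog]. *)
Lemma H_enum : H :=: [set 1; y; z; z * y]%g.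
Proof.
have zy : (z \in 'C[y])%g by apply/cent1P; rewrite /commute; perm4.
apply/setP => g; rewrite /H /= inE G_enum; apply/andP/idP => [[g_eq gC]|].
- move: g_eq; rewrite !inE -!orbA.
  do ?[case/orP]; move/eqP => gE; rewrite gE ?eqxx ?orbT //; move: gC;
    rewrite gE (perm_notin_cent1 (a := 0)) //; by perm_eval.
- move=> g_eq; have /or4P g_or : [|| g == 1, g == y, g == z | g == z * y]%g.
    by move: g_eq; rewrite !inE -!orbA.
  split; first by rewrite !inE; case: g_or => /eqP->; rewrite eqxx ?orbT.
  by case: g_or => /eqP->; rewrite ?(cent1id, zy, group1, groupM).
Qed.

Lemma K_enum : K :=: [set 1; x; z; z * x]%g.
Proof.
have zx : (z \in 'C[x])%g by rewrite groupX ?cent1id.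
apply/setP => g; rewrite /K /= inE G_enum; apply/andP/idP => [[g_eq gC]|].
- move: g_eq; rewrite !inE -!orbA.
  do ?[case/orP]; move/eqP => gE; rewrite gE ?eqxx ?orbT //; move: gC;
    rewrite gE (perm_notin_cent1 (a := 0)) //; by perm_eval.
- move=> g_eq; have /or4P g_or : [|| g == 1, g == x, g == z | g == z * x]%g.
    by move: g_eq; rewrite !inE -!orbA.
  split; first by rewrite !inE; case: g_or => /eqP->; rewrite eqxx ?orbT.
  by case: g_or => /eqP->; rewrite ?(cent1id, zx, group1, groupM).
Qed.

Lemma GH_enum : G :\: H = [set x; y * x; z * x; z * y * x]%g.
Proof.
have GE g : g \in G -> (g \in H) || (g \in [set x; y * x; z * x; z * y * x]%g).
  rewrite G_enum H_enum !inE -!orbA.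
  by do ?[case/orP]; move/eqP => ->; rewrite eqxx ?orbT.
apply/eqP; rewrite eqEsubset; apply/andP; split; apply/subsetP => g.
  by case/setDP => /GE/orP[-> |].
rewrite in_setD G_enum !inE => g_eq; apply/andP; split; last first.
  by move: g_eq; rewrite -!orbA => /or4P[] ->; rewrite ?orbT.
suff: g \notin 'C[y]%g by apply: contra; rewrite /H /= inE => /andP[].
move: g_eq; rewrite -!orbA => /or4P[] /eqP ->;
  rewrite (perm_notin_cent1 (a := 0)) //; by perm_eval.
Qed.

(** Writing the coset as multiples of [x * y] makes the images under [tau] multiples of
    [w = tau (x * y)] by [sigma x] and [sigma z]. *)
Lemma GK_enum : G :\: K = [set x * y; x * (x * y); z * (x * y); z * x * (x * y)]%g.
Proof.
have xyE : (x * y = z * y * x)%g by perm4.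
have xxyE : (x * (x * y) = z * y)%g by rewrite mulgA.
have zxyE : (z * (x * y) = y * x)%g by perm4.
have zxxyE : (z * x * (x * y) = y)%g by perm4.
rewrite zxxyE zxyE xxyE xyE.
have GE g : g \in G -> (g \in K) || (g \in [set z * y * x; z * y; y * x; y]%g).
  rewrite G_enum K_enum !inE -!orbA.
  by do ?[case/orP]; move/eqP => ->; rewrite eqxx ?orbT.
apply/eqP; rewrite eqEsubset; apply/andP; split; apply/subsetP => g.
  by case/setDP => /GE/orP[-> |].
rewrite in_setD G_enum !inE => g_eq; apply/andP; split; last first.
  by move: g_eq; rewrite -!orbA => /or4P[] ->; rewrite ?orbT.
suff: g \notin 'C[x]%g by apply: contra; rewrite /K /= inE => /andP[].
move: g_eq; rewrite -!orbA => /or4P[] /eqP ->;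
  rewrite (perm_notin_cent1 (a := 0)) //; by perm_eval.
Qed.

(** * Valency and intersection numbers of a rank 3 scheme with [A2 = A1^T] *)

Lemma mul_const_mx1 (R : pzSemiRingType) m n p :
  (const_mx 1 : 'M[R]_(m, n)) *m (const_mx 1 : 'M_(n, p)) = const_mx n%:R.
Proof.
apply/matrixP => i j; rewrite !mxE.
under eq_bigr do rewrite !mxE mulr1.
by rewrite sumr_const card_ord.
Qed.

Lemma span3P (K : fieldType) (V : vectType K) (e0 e1 e2 u : V) :
  u \in <<[:: e0; e1; e2]>>%VS ->
  exists c0 c1 c2, u = c0 *: e0 + c1 *: e1 + c2 *: e2.
Proof.
rewrite !span_cons span_nil addv0.
case/memv_addP => _ /vlineP[c0 ->] [v + ->].
case/memv_addP => _ /vlineP[c1 ->] [_ /vlineP[c2 ->] ->].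
by exists c0, c1, c2; rewrite addrA.
Qed.

Section Rank3.
Variables (a : nat) (A1 A2 : 'M[rat]_a).
Hypotheses (schemeA : assoc_scheme [:: 1%:M; A1; A2]) (trA1 : A2 = A1^T).

Let k : rat := (a%:R - 1) / 2.
Let J : 'M[rat]_a := const_mx 1.

Let A1_entries : A1 != 0 /\ forall i j, A1 i j = 0 \/ A1 i j = 1.
Proof. by case: schemeA => _ + _ _ _; apply; rewrite !inE eqxx orbT. Qed.

Let A1_neq0 : A1 != 0. Proof. by case: A1_entries. Qed.

Lemma rank3_order_gt0 : (0 < a)%N.
Proof.
rewrite lt0n; apply: contra A1_neq0 => /eqP a0.
by apply/eqP/matrixP => i; have := ltn_ord i; rewrite [X in (_ < X)%N]a0.
Qed.

Let A1_01 i j : A1 i j = 0 \/ A1 i j = 1.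
Proof. by case: A1_entries. Qed.

Lemma rank3_sum : A1 + A2 = J - 1%:M.
Proof.
case: schemeA => _ _ _ + _; rewrite !big_cons big_nil addr0 => sumE.
by rewrite /J -sumE [RHS]addrC addKr.
Qed.

Let A1_diag i : A1 i i = 0.
Proof.
have /matrixP/(_ i i) := rank3_sum; rewrite trA1 !mxE eqxx subrr.
by move/eqP; rewrite -mulr2n mulrn_eq0 => /eqP.
Qed.

Let A1A2 : exists b0 b1 b2, A1 *m A2 = b0 *: 1%:M + b1 *: A1 + b2 *: A2.
Proof.
case: schemeA => _ _ _ _ /(_ A1 A2); rewrite !inE !eqxx !orbT.
by case=> // _ /span3P.
Qed.

(** [A1] is the adjacency matrix of a tournament, so in-degree and out-degree add up to the number
    of other vertices. *)
Let col_row l : \sum_j A1 j l + \sum_j A1 l j = a%:R - 1.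
Proof.
rewrite addrC -big_split /=.
transitivity (\sum_j (1 - (j == l)%:R) : rat).
  apply: eq_bigr => j _; have /matrixP/(_ l j) := rank3_sum.
  by rewrite trA1 !mxE eq_sym.
rewrite sumrB sumr_const card_ord (bigD1 l) //= eqxx big1 ?addr0 //.
by move=> j /negPf->.
Qed.

(** As [A1] has entries 0 and 1, the diagonal of [A1 *m A1^T] consists of the row sums; it is the
    constant [b0], since [A1] and [A2] vanish on the diagonal. Counting the ones of [A1] by rows and
    by columns then gives [b0 = a - 1 - b0]. *)
Let row_sum i : \sum_j A1 i j = k.
Proof.
case: A1A2 => b0 [b1 [b2 A1A2E]].
have rowE l : \sum_j A1 l j = b0.
  have /matrixP/(_ l l) := A1A2E; rewrite trA1 !mxE A1_diag eqxx
    !mulr0 !addr0 mulr1.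
  move=> <-; apply: eq_bigr => j _; rewrite !mxE.
  by case: (A1_01 l j) => ->; rewrite ?mulr0 ?mulr1.
have colE l : \sum_j A1 j l = a%:R - 1 - b0 by rewrite -(rowE l) -(col_row l) addrK.
rewrite rowE.
have : \sum_i \sum_j A1 i j = \sum_j \sum_i A1 i j by exact: exchange_big.
under eq_bigr do rewrite rowE.
under [RHS]eq_bigr do rewrite colE.
rewrite !sumr_const card_ord => /eqP.
rewrite eqr_pMn2r ?rank3_order_gt0 // => /eqP b0E.
by rewrite /k; lra.
Qed.

Let A1J p : A1 *m const_mx 1 = k *: const_mx 1 :> 'M_(a, p).
Proof.
apply/matrixP => i j; rewrite !mxE mulr1 -(row_sum i).
by apply: eq_bigr => l _; rewrite mxE mulr1.
Qed.

Let JA1 p : const_mx 1 *m A1 = k *: const_mx 1 :> 'M_(p, a).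
Proof.
apply/matrixP => i j; rewrite !mxE mulr1.
transitivity (\sum_l A1 l j); first by apply: eq_bigr => l _; rewrite mxE mul1r.
by have := col_row j; rewrite row_sum /k; lra.
Qed.

Let A2E : A2 = J - 1%:M - A1.
Proof. by rewrite -rank3_sum addrC addKr. Qed.

Let A2J p : A2 *m const_mx 1 = k *: const_mx 1 :> 'M_(a, p).
Proof.
rewrite A2E !mulmxBl mul1mx A1J mul_const_mx1.
by apply/matrixP => i j; rewrite !mxE /k; field.
Qed.

Let JA2 p : const_mx 1 *m A2 = k *: const_mx 1 :> 'M_(p, a).
Proof.
rewrite A2E !mulmxBr mulmx1 JA1 mul_const_mx1.
by apply/matrixP => i j; rewrite !mxE /k; field.
Qed.

Let A2A1 : A2 *m A1 = A1 *m A2.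
Proof. by rewrite A2E !mulmxBl !mulmxBr mul1mx mulmx1 JA1 A1J. Qed.

Let k_neq0 : k != 0.
Proof.
apply: contra A1_neq0 => /eqP k0; apply/eqP/matrixP => i j; rewrite mxE.
apply/eqP; have /eqP := row_sum i; rewrite k0 psumr_eq0 => [/allP|l _].
  by apply; rewrite mem_index_enum.
by case: (A1_01 i l) => ->.
Qed.

(** The tournament is doubly regular. Symmetry of [A1 *m A1^T] with [A1 != A2] forces [b1 = b2], the
    diagonal gives [b0 = k], and row sums determine [b2]. *)
Let A1A2E : A1 *m A2 = k *: 1%:M + ((k - 1) / 2) *: (J - 1%:M).
Proof.
case: A1A2 => b0 [b1 [b2 A1A2E]].
have b12 : b1 = b2.
  have A12 : A1 - A2 != 0.
    rewrite subr_eq0; case: schemeA => + _ _ _ _.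
    by rewrite /= !inE => /and3P[].
  apply/eqP; rewrite -subr_eq0; have := congr1 trmx A1A2E.
  rewrite trmx_mul trA1 trmxK -trA1 A1A2E !linearD !linearZ /= tr_scalar_mx.
  rewrite trA1 trmxK -trA1 => /eqP; rewrite -subr_eq0.
  set M := (X in X == 0); have -> : M = (b1 - b2) *: (A1 - A2).
    by rewrite /M; apply/matrixP => i j; rewrite !mxE; ring.
  by rewrite scaler_eq0 (negPf A12) orbF.
have i0 : 'I_a := Ordinal rank3_order_gt0.
have b0E : b0 = k.
  have /matrixP/(_ i0 i0) := A1A2E; rewrite trA1 !mxE A1_diag eqxx
    !mulr0 !addr0 mulr1.
  move=> <-; rewrite -(row_sum i0); apply: eq_bigr => j _; rewrite !mxE.
  by case: (A1_01 i0 j) => ->; rewrite ?mulr0 ?mulr1.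
rewrite A1A2E b0E b12 -addrA -scalerDr rank3_sum.
suff -> : b2 = (k - 1) / 2 by [].
(* Applied to the all-ones vector, the identity reads [k^2 = k + b2 (a - 1) = k + 2 k b2], from
   which [k] cancels. *)
have : A1 *m A2 *m (const_mx 1 : 'cV_a) =
       (k *: 1%:M + b2 *: (J - 1%:M)) *m const_mx 1.
  by rewrite A1A2E b0E b12 -addrA -scalerDr rank3_sum.
rewrite -mulmxA A2J -scalemxAr A1J mulmxDl -!scalemxAl mulmxBl !mul1mx.
rewrite mul_const_mx1 => /matrixP/(_ i0 0); rewrite !mxE => e.
apply: (mulfI k_neq0); move: e; rewrite /k => e; lra.
Qed.

(** The extra [J] is the contribution of the border blocks, so that the bordered matrices satisfy a
    relation without it. *)
Lemma rank3_mul_tr : A1 *m A2 + A2 *m A1 + J = a%:R%:M + k *: (A1 + A2).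
Proof.
rewrite A2A1 A1A2E rank3_sum.
by apply/matrixP => i j; rewrite !mxE /k; field.
Qed.

(** Replacing one factor by its complement in [J - 1] reduces both squares to the known mixed
    product. *)
Lemma rank3_sqr : A1 *m A1 + A2 *m A2 = k *: (A1 + A2).
Proof.
have -> : A2 *m A2 = A2 *m (J - 1%:M - A1) by rewrite -A2E.
have -> : A1 *m A1 = A1 *m (J - 1%:M - A2) by rewrite -rank3_sum addrK.
rewrite !mulmxBr !mulmx1 A2A1 A1J.
rewrite A2J A1A2E rank3_sum; have := rank3_sum => /matrixP A12.
apply/matrixP => i j; have := A12 i j; rewrite !mxE /k => e.
have -> : A1 i j = 1 - (i == j)%:R - A2 i j by rewrite -e; ring.
by field.
Qed.


Local Notation E := (Emx a).
Local Notation T1 := (Atilde A1).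
Local Notation T2 := (Atilde A2).
Local Notation B1 := (Ahat1 A1).
Local Notation B2 := (Ahat2 A2).

Let EE : E *m E = block_mx a%:R%:M 0 0 J.
Proof.
rewrite mulmx_block !(mul0mx, mulmx0, addr0, add0r) !mul_const_mx1; congr block_mx.
by apply/matrixP => i j; rewrite !mxE !ord1.
Qed.

(** This and the next three identities give the coefficients of the permutation matrices of [z],
    [1], [y] and [z * y] in the square of [mu A1 A2 x]. *)
Lemma Emx_Atilde_mul_tr : E *m E + T1 *m T2 + T2 *m T1 = a%:R%:M + k *: (T1 + T2).
Proof.
rewrite EE !mulmx_block !(mul0mx, mulmx0, addr0, add0r) !add_block_mx.
rewrite scale_block_mx scalar_mx_block add_block_mx.
rewrite !(addr0, scaler0) -rank3_mul_tr; congr block_mx.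
by rewrite -addrA addrC.
Qed.

Lemma Atilde_sqr : T1 *m T1 + T2 *m T2 = k *: (T1 + T2).
Proof.
rewrite !mulmx_block !(mul0mx, mulmx0, addr0, add0r) !add_block_mx.
by rewrite scale_block_mx !(addr0, scaler0) rank3_sqr.
Qed.

Lemma Atilde1_Emx : T1 *m E = k *: E - E *m T2.
Proof.
rewrite !mulmx_block !(mul0mx, mulmx0, addr0, add0r) opp_block_mx scale_block_mx.
by rewrite add_block_mx !(addr0, add0r, scaler0, oppr0) A1J JA2 subrr.
Qed.

Lemma Atilde2_Emx : T2 *m E = k *: E - E *m T1.
Proof.
rewrite !mulmx_block !(mul0mx, mulmx0, addr0, add0r) opp_block_mx scale_block_mx.
by rewrite add_block_mx !(addr0, add0r, scaler0, oppr0) A2J JA1 subrr.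
Qed.

(** This and the next identity give the coefficients of [z] and [1] in the square of
    [tau A1 A2 (x * y)]. *)
Lemma Ahat_mul_tr : B1 *m B2 + B2 *m B1 = a%:R%:M + k *: (B1 + B2).
Proof.
rewrite !mulmx_block !(mul0mx, mulmx0, addr0, add0r) !add_block_mx.
rewrite scale_block_mx scalar_mx_block add_block_mx.
rewrite !(addr0, add0r, scaler0) !mul_const_mx1 A1J JA2.
rewrite -rank3_mul_tr; congr block_mx; last by rewrite [in RHS]addrAC addrA.
by apply/matrixP => i j; rewrite !mxE !ord1.
Qed.

Lemma Ahat_sqr : B1 *m B1 + B2 *m B2 = k *: (B1 + B2).
Proof.
rewrite !mulmx_block !(mul0mx, mulmx0, addr0, add0r) !add_block_mx.
by rewrite scale_block_mx !(addr0, add0r, scaler0) JA1 A2J rank3_sqr.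
Qed.

End Rank3.

(** * Kronecker products, linear independence and spans *)

Lemma tensmx11 (R : pzRingType) m n : 1%:M *t 1%:M = 1%:M :> 'M[R]_(m * n).
Proof.
apply/matrixP => i j; case: (mxtens_indexP i) => i0 i1.
case: (mxtens_indexP j) => j0 j1.
rewrite tensmxE !mxE (can_eq (@mxtens_indexK m n)) xpair_eqE.
by case: eqP; rewrite ?mul0r ?mul1r.
Qed.

(** Row [i0] alone detects independence: its entry in column [c i] reads off the [i]-th coefficient
    of a linear combination. *)
Lemma free_entries (K : fieldType) m n (S : seq 'M[K]_(m, n)) i0
    (c : 'I_(size S) -> 'I_n) :
  (forall i j : 'I_(size S), S`_j i0 (c i) = (j == i)%:R) -> free S.
Proof.
move=> S_c; rewrite -[S]/(tval (in_tuple S)); apply/freeP => k k0 i.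
have /matrixP/(_ i0 (c i)) := k0.
rewrite summxE (bigD1 i) //= big1 => [|j /negPf ne]; rewrite !mxE S_c ?eqxx ?ne.
  by rewrite mulr1 addr0.
by rewrite mulr0.
Qed.

(** A span depends only on membership, so the enumeration order of a set of permutations can be
    replaced by an explicit list. *)
Lemma eq_span_images (V : vectType rat) (f g : 'S_4 -> V) (A B : {set 'S_4})
    h0 h1 h2 h3 g0 g1 g2 g3 :
  A = [set h0; h1; h2; h3] -> B = [set g0; g1; g2; g3] ->
  <<[seq f h | h in A] ++ [seq g h | h in B]>>%VS =
  <<[:: f h0; f h1; f h2; f h3; g g0; g g1; g g2; g g3]>>%VS.
Proof.
move=> -> ->; apply: eq_span => X; rewrite mem_cat !inE; apply/idP/idP.
  by case/orP => /imageP[h]; rewrite !inE -!orbA => /or4P[] /eqP-> ->;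
     rewrite eqxx ?orbT.
rewrite !orbA; do ?[case/orP]; move=> /eqP->; apply/orP;
  [left..|right|right|right|right];
  by apply: image_f; rewrite !inE eqxx ?orbT.
Qed.

(** * Multiplication rules and linear relations in both schemes *)

Section Relations.
Variable a : nat.
Implicit Types g h : 'S_4.

Let sigma := @sigma a.

Lemma sigmaM g h : sigma (g * h)%g = sigma g *m sigma h.
Proof. by rewrite /sigma /Defs.sigma tensmx_mul mulmx1 perm_mxM. Qed.

Lemma sigma1 : sigma 1 = 1%:M.
Proof. by rewrite /sigma /Defs.sigma perm_mx1 tensmx11. Qed.

Lemma sigma_mu A1 A2 g h : sigma g *m mu A1 A2 h = mu A1 A2 (g * h).
Proof.
by rewrite !mulmxDr !tensmx_mul !mul1mx -!perm_mxM !(mulgA g).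
Qed.

(** On the right, [g] has to pass the factors [y] and [z] to reach [h]. *)
Lemma mu_sigma A1 A2 g h : commute g y -> commute g z ->
  mu A1 A2 h *m sigma g = mu A1 A2 (h * g).
Proof.
move=> gy gz; rewrite /mu -(mulgA h g y) gy (mulgA h y g) -(mulgA h g z) gz.
rewrite (mulgA h z g) -(mulgA _ g y) gy (mulgA _ y g).
by rewrite !mulmxDl !tensmx_mul !mulmx1 -!perm_mxM.
Qed.

Lemma sigma_tau A1 A2 g h : sigma g *m tau A1 A2 h = tau A1 A2 (g * h).
Proof. by rewrite !mulmxDr !tensmx_mul !mul1mx -!perm_mxM !(mulgA g). Qed.

Lemma tau_sigma A1 A2 g h : commute g z ->
  tau A1 A2 h *m sigma g = tau A1 A2 (h * g).
Proof.
move=> gz; rewrite /tau -(mulgA h g z) gz (mulgA h z g).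
by rewrite !mulmxDl !tensmx_mul !mulmx1 -!perm_mxM.
Qed.

(* The eight permutation matrices of [G] span a space of dimension 6 only; the
   two linear relations among them yield the quadratic equations for [mu x] and
   [tau (x * y)]. *)
Lemma perm_mx_xE :
  perm_mx x = perm_mx y + perm_mx (z * y) - perm_mx (z * x) :> 'M[rat]_4.
Proof.
apply/matrixP => i j; rewrite !mxE.
by case: (ord4P i) => ->; case: (ord4P j) => ->; perm_eval.
Qed.

Lemma perm_mx_zyxE :
  perm_mx (z * y * x) = 1%:M + perm_mx z - perm_mx (y * x) :> 'M[rat]_4.
Proof.
apply/matrixP => i j; rewrite !mxE.
by case: (ord4P i) => ->; case: (ord4P j) => ->; perm_eval.
Qed.

End Relations.

(** * Quadratic relations, independence and the two isomorphisms *)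

Section Schemes.
Variables (a : nat) (A1 A2 : 'M[rat]_a).
Hypotheses (schemeA : assoc_scheme [:: 1%:M; A1; A2]) (trA1 : A2 = A1^T).

Local Notation P g := (perm_mx g : 'M[rat]_4).

Lemma mu_sqr : mu A1 A2 x *m mu A1 A2 x =
  a%:R *: sigma a z + ((a%:R - 1) / 2) *: (mu A1 A2 x + sigma a z *m mu A1 A2 x).
Proof.
have wE : mu A1 A2 x =
    Emx a *t P x + Atilde A1 *t P (z * y * x)%g + Atilde A2 *t P (y * x)%g.
  by congr (_ + _ *t perm_mx _ + _ *t perm_mx _); perm4.
have zwE : mu A1 A2 (z * x) =
    Emx a *t P (z * x)%g + Atilde A1 *t P (y * x)%g + Atilde A2 *t P (z * y * x)%g.
  by congr (_ + _ *t perm_mx _ + _ *t perm_mx _); perm4.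
have e0 : (x * x = z)%g by perm4.
have e1 : (x * (y * x) = y)%g by perm4.
have e2 : (x * (z * y * x) = z * y)%g by perm4.
have e3 : (z * y * x * x = y)%g by perm4.
have e4 : (z * y * x * (z * y * x) = 1)%g by perm4.
have e5 : (z * y * x * (y * x) = z)%g by perm4.
have e6 : (y * x * x = z * y)%g by perm4.
have e7 : (y * x * (z * y * x) = z)%g by perm4.
have e8 : (y * x * (y * x) = 1)%g by perm4.
rewrite sigma_mu zwE wE !mulmxDl !mulmxDr !tensmx_mul -!perm_mxM.
rewrite e0 e1 e2 e3 e4 e5 e6 e7 e8 perm_mx1 /sigma.
(* In [w + z w] the permutation matrices occur in the sums [x + z x] and [y x + z y x]; these become
   [y + z y] and [1 + z], which are the ones occurring in the square. *)
rewrite perm_mx_xE perm_mx_zyxE.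
rewrite (Atilde1_Emx schemeA trA1) (Atilde2_Emx schemeA trA1).
have := Atilde_sqr schemeA trA1; have := Emx_Atilde_mul_tr schemeA trA1.
move: (Emx a) (Atilde A1) (Atilde A2) => E T1 T2.
rewrite -addrA => /(canRL (addrK _)) ->  /(canRL (addrK _)) ->.
rewrite -scalemx1; apply/matrixP => i j; rewrite !mxE.
by field.
Qed.

(** The square only involves [1] and [z], so the single linear relation [y x + z y x = 1 + z] is
    enough. *)
Lemma tau_sqr : tau A1 A2 (x * y) *m tau A1 A2 (x * y) =
  a%:R *: sigma a z +
    ((a%:R - 1) / 2) *: (tau A1 A2 (x * y) + sigma a z *m tau A1 A2 (x * y)).
Proof.
have wE : tau A1 A2 (x * y) = Ahat1 A1 *t P (z * y * x)%g + Ahat2 A2 *t P (y * x)%g.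
  by congr (_ *t perm_mx _ + _ *t perm_mx _); perm4.
have zwE : tau A1 A2 (z * (x * y)) =
    Ahat1 A1 *t P (y * x)%g + Ahat2 A2 *t P (z * y * x)%g.
  by congr (_ *t perm_mx _ + _ *t perm_mx _); perm4.
have e4 : (z * y * x * (z * y * x) = 1)%g by perm4.
have e5 : (z * y * x * (y * x) = z)%g by perm4.
have e7 : (y * x * (z * y * x) = z)%g by perm4.
have e8 : (y * x * (y * x) = 1)%g by perm4.
rewrite sigma_tau zwE wE !mulmxDl !mulmxDr !tensmx_mul -!perm_mxM.
rewrite e4 e5 e7 e8 perm_mx1 /sigma perm_mx_zyxE.
have := Ahat_sqr schemeA trA1; have := Ahat_mul_tr schemeA trA1.
move: (Ahat1 A1) (Ahat2 A2) => T1 T2.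
move=> /(canRL (addrK _)) ->  /(canRL (addrK _)) ->.
rewrite -scalemx1; apply/matrixP => i j; rewrite !mxE.
by field.
Qed.

Lemma sigma_entry h j l :
  sigma a h (mxtens_index (lshift a 0, 0)) (mxtens_index (j, l)) =
  (j == lshift a 0)%:R * (h 0 == l)%:R.
Proof. by rewrite tensmxE !mxE eq_sym. Qed.

(** Only [Emx] contributes to the first row, the two other terms being zero there; for [tau] it is
    only [Ahat1], whose first row is the same. *)
Lemma mu_entry g j l :
  mu A1 A2 g (mxtens_index (lshift a 0, 0)) (mxtens_index (j, l)) =
  (j != lshift a 0)%:R * (g 0 == l)%:R.
Proof.
rewrite mxE [X in X + _]mxE !tensmxE; case: (split_ordP j) => k ->.
  by rewrite !block_mxEul !mxE !mul0r !addr0 ord1 eqxx mul0r.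
by rewrite !block_mxEur !mxE !mul0r !addr0 eq_rlshift.
Qed.

Lemma tau_entry g j l :
  tau A1 A2 g (mxtens_index (lshift a 0, 0)) (mxtens_index (j, l)) =
  (j != lshift a 0)%:R * (g 0 == l)%:R.
Proof.
rewrite mxE !tensmxE; case: (split_ordP j) => k ->.
  by rewrite !block_mxEul !mxE !mul0r !addr0 ord1 eqxx mul0r.
by rewrite !block_mxEur !mxE !mul0r !addr0 eq_rlshift.
Qed.

(** In the first row the [sigma] matrices live in block column 0 and the others outside it; within
    each family the image of the point 0 tells the permutations apart. *)
Lemma free_scheme (m : 'S_4 -> 'M[rat]_((1 + a) * 4)) (hs gs : seq 'S_4) :
  (forall g j l,
     m g (mxtens_index (lshift a 0, 0)) (mxtens_index (j, l)) =
     (j != lshift a 0)%:R * (g 0 == l)%:R) ->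
  uniq [seq h 0 | h : 'S_4 <- hs] -> uniq [seq g 0 | g : 'S_4 <- gs] ->
  free ([seq sigma a h | h <- hs] ++ [seq m g | g <- gs]).
Proof.
move=> m_entry uh ug; set S := _ ++ _.
(* Any column of the second block would do; one exists because [a] is positive. *)
pose j0 := Ordinal (rank3_order_gt0 schemeA).
pose c (i : 'I_(size S)) := if (i < size hs)%N
  then mxtens_index (lshift a 0, nth 1%g hs i 0)
  else mxtens_index (rshift 1 j0, nth 1%g gs (i - size hs) 0).
have nth_inj (s : seq 'S_4) i j : uniq [seq h 0 | h : 'S_4 <- s] ->
    (i < size s)%N -> (j < size s)%N -> (nth 1%g s i 0 == nth 1%g s j 0) = (i == j).
  move=> us i_lt j_lt; rewrite -!(nth_map 1%g 0 (fun h : 'S_4 => h 0)) //.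
  by rewrite nth_uniq ?size_map.
apply: (@free_entries _ _ _ S (mxtens_index (lshift a 0, 0)) c) => i j.
have size_S : size S = (size hs + size gs)%N by rewrite size_cat !size_map.
have [i_lt j_lt] : (i < size hs + size gs)%N /\ (j < size hs + size gs)%N.
  by rewrite -size_S !ltn_ord.
rewrite nth_cat size_map /c; case: (ltnP j) => jh; case: (ltnP i) => ih.
- rewrite (nth_map 1%g) // sigma_entry eqxx mul1r nth_inj //.
- rewrite (nth_map 1%g) // sigma_entry eq_rlshift mul0r; case: eqP => // ij.
  by move: ih; rewrite -ij leqNgt jh.
- rewrite (nth_map 1%g) ?m_entry ?eqxx ?mul0r; last by rewrite ltn_subLR.
  by case: eqP => // ij; move: ih; rewrite -ij ltnNge jh.
rewrite (nth_map 1%g) ?m_entry ?eq_rlshift ?mul1r; last by rewrite ltn_subLR.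
rewrite nth_inj ?ltn_subLR //; congr (_%:R).
by rewrite -(eqn_add2l (size hs)) !subnKC.
Qed.

Lemma isog_D :
  matalg_isog (adjacency_algebra (scheme_D A1 A2))
    (rat^o * rat^o * rat^o * rat^o * quaternion (1 : rat) (- a%:R))%type.
Proof.
rewrite /adjacency_algebra (eq_span_images _ _ H_enum GH_enum).
have := twisted_isog (t := sigma a y) (w := mu A1 A2 x) (z := sigma a z)
  (r := 1) (a := a%:R).
(* Products are merged into single values of [sigma] and [mu], so that most hypotheses become
   equalities of permutations. *)
rewrite -!sigmaM !sigma_mu -(sigma1 a).
apply.
- by congr sigma; perm4.
- by congr sigma; perm4.
- by rewrite mu_sigma; [congr mu; perm4 | rewrite /commute; perm4..].
- rewrite subrr mul0r scale0r addr0 (_ : (1 + 1) / 2 = 1) // scale1r.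
  by congr sigma; perm4.
- by rewrite mu_sigma ?sigma_mu;
    [congr mu; perm4 | rewrite /commute; perm4..].
- by rewrite mu_sqr sigma_mu.
- by rewrite -(natrD _ a 1) pnatr_eq0 addn1.
apply: (free_scheme (m := mu A1 A2) (hs := [:: 1; y; z; z * y]%g)
  (gs := [:: x; y * x; z * x; z * y * x]%g) mu_entry).
by perm_eval.
by perm_eval.
Qed.

Lemma isog_Q :
  matalg_isog (adjacency_algebra (scheme_Q A1 A2))
    (rat^o * rat^o * rat^o * rat^o * quaternion (-1 : rat) (- a%:R))%type.
Proof.
rewrite /adjacency_algebra (eq_span_images _ _ K_enum GK_enum).
have := twisted_isog (t := sigma a x) (w := tau A1 A2 (x * y)) (z := sigma a z)
  (r := -1) (a := a%:R).
rewrite -!sigmaM !sigma_tau -(sigma1 a).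
apply.
- by congr sigma; perm4.
- by congr sigma; perm4.
- by rewrite tau_sigma; [congr tau; perm4| rewrite /commute; perm4].
(* For [r = -1] only the coefficient of [z] survives, and the relation is [x * x = z]. *)
- rewrite subrr mul0r scale0r add0r (_ : (1 - -1) / 2 = 1) // scale1r.
  by congr sigma; perm4.
- by rewrite tau_sigma ?sigma_tau; [congr tau; perm4| rewrite /commute; perm4].
- by rewrite tau_sqr sigma_tau.
- by rewrite -(natrD _ a 1) pnatr_eq0 addn1.
apply: (free_scheme (m := tau A1 A2) (hs := [:: 1; x; z; z * x]%g)
  (gs := [:: x * y; x * (x * y); z * (x * y); z * x * (x * y)]%g) tau_entry).
by perm_eval.
by perm_eval.
Qed.

End Schemes.

Theorem proposition5p3 (a : nat) (A1 A2 : 'M[rat]_a)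
    (schemeA : assoc_scheme [:: 1%:M; A1; A2])
    (nonsymA : ~ symmetric_scheme [:: 1%:M; A1; A2])
    (trA1 : A2 = A1^T) :
  matalg_isog (adjacency_algebra (scheme_D A1 A2))
    (rat^o * rat^o * rat^o * rat^o * 'M[rat]_2)%type
  /\ matalg_isog (adjacency_algebra (scheme_Q A1 A2))
       (rat^o * rat^o * rat^o * rat^o * quaternion (-1 : rat) (- a%:R))%type
  /\ division_algebra (quaternion (-1 : rat) (- a%:R)).
Proof.
have a0 : 0 < a%:R :> rat by rewrite ltr0n (rank3_order_gt0 schemeA).
split; last by split; [apply: isog_Q | apply: quaternion_division].
(* The factor Q(1, -a) splits because [-a] is nonzero. *)
by apply: (@matalg_isog_mx2 _ _ (- a%:R)); [rewrite oppr_eq0 gt_eqF | apply: isog_D].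
Qed.
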